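(* Let $n\geq 2$ and $d\geq 1$ be integers with $\gcd(n,d)=1$, let $r$ be an integer, and let $f_0(q),f_1(q),\ldots,f_{n-1}(q)\in\mathbb Z[q]$. For $0\le k\le n-1$ put $$\hat{f}_k(q)=\sum_{j=0}^k(-1)^jq^{\binom{j+1}{2}}\begin{bmatrix}k\\ j\end{bmatrix}_q f_j(q).$$ Let $a\in\{0,1,\ldots,n-1\}$ be the unique integer with $ad\equiv -r\pmod n$ (i.e. $a=\langle -r/d\rangle_n$). Then, if $n$ is odd, \begin{align*} &q^{d\binom{a+1}2+\frac{(ad+r)(n-1-2a)}{2}}\sum_{k=0}^{n-1} \frac{(q^r;q^d)_k(q^{d-r};q^d)_k}{(q^d;q^d)_k^2}\, q^{dk}f_k(q^d)\\ \equiv\;& (-1)^a\sum_{k=0}^{n-1}\frac{(q^r;q^d)_k(q^{d-r};q^d)_k}{(q^d;q^d)_k^2}\, q^{dk}\hat{f}_k(q^d)\pmod{\Phi_n(q)^2}, \end{align*} and, if $n$ is even, \begin{align*} &q^{d\binom{a+1}2+\frac{(ad+r)(n-1-2a)}{2}}\sum_{k=0}^{n-1} \frac{(q^r;q^d)_k(q^{d-r};q^d)_k}{(q^d;q^d)_k^2}\, q^{dk}f_k(q^d)\\ \equiv\;& (-1)^{a+\frac{ad+r}{n}}\sum_{k=0}^{n-1}\frac{(q^r;q^d)_k(q^{d-r};q^d)_k}{(q^d;q^d)_k^2}\, q^{dk}\hat{f}_k(q^d)\pmod{\Phi_n(q)^2}. \end{align*} Here $\hat f_k(q^d)$ and $f_k(q^d)$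 denote the polynomials $\hat f_k$, $f_k$ evaluated at $q^d$.
   Context: For $x$ and an integer $n\ge 0$, $(x;q)_n=(1-x)(1-xq)\cdots(1-xq^{n-1})$ for $n\ge1$ and $(x;q)_0=1$. The $q$-binomial coefficient is $\begin{bmatrix}\alpha\\ k\end{bmatrix}_q=\frac{(q^{\alpha-k+1};q)_k}{(q;q)_k}$ for $k\ge 0$ (and $0$ for $k<0$); for integers $0\le j\le k$ this is the Gaussian binomial coefficient. $\Phi_n(q)$ is the $n$-th cyclotomic polynomial. Since $r$ may be negative, the expressions are rational functions in $q$ whose denominators (powers of $q$ and factors $1-q^{dj}$ with $1\le j\le n-1$) are coprime to $\Phi_n(q)$; a congruence $A\equiv B\pmod{\Phi_n(q)^2}$ between such rational functions means that $A-B=\Phi_n(q)^2\,P(q)/Q(q)$ with $P,Q\in\mathbb Z[q]$ and $Q$ coprime to $\Phi_n(q)$. Note that $ad+r$ is divisible by $n$, so $\frac{ad+r}{n}$ is an integer, and the exponent $\frac{(ad+r)(n-1-2a)}{2}$ is an integer. *)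

(* Defs.v *)
From HB Require Import structures.
From mathcomp Require Import all_boot all_order all_algebra all_field.
Set Implicit Arguments. Unset Strict Implicit. Unset Printing Implicit Defensive.
Import Order.TTheory GRing.Theory Num.Theory.
Local Open Scope ring_scope.

Definition ratfun := {fraction {poly int}}.

Definition polyF (p : {poly int}) : ratfun := @FracField.tofrac _ p.

Definition qF : ratfun := polyF 'X.

Definition qpoch (x y : ratfun) (k : nat) : ratfun :=
  \prod_(i < k) (1 - x * y ^+ i).

(* Gaussian binomial [k choose j] in base y, as in the context:
   (y^(k-j+1); y)_j / (y; y)_j  (for 0 <= j <= k). *)
Definition qbinom (y : ratfun) (k j : nat) : ratfun :=
  qpoch (y ^+ (k - j).+1) y j / qpoch y y j.

Definition peval (f : {poly int}) (x : ratfun) : ratfun :=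
  (map_poly (fun c : int => c%:~R : ratfun) f).[x].

Definition fhat (f : nat -> {poly int}) (y : ratfun) (k : nat) : ratfun :=
  \sum_(0 <= j < k.+1) (-1) ^+ j * y ^+ 'C(j.+1, 2) * qbinom y k j * peval (f j) y.

Definition congr_Phi2 (n : nat) (A B : ratfun) : Prop :=
  exists P Q : {poly int},
    Q != 0 /\ coprimep Q 'Phi_n /\
    A - B = polyF ('Phi_n ^+ 2 * P) / polyF Q.

(* Main.v *)
(** Put y = q^d, write r = n m - a d, and for an integer s let
    x_s = y^(-a) q^(n s), so that q^r = x_m. Replace q^r by x_s, and replace the
    power of q on the left by y^C(a+1,2) Q^(v s), where Q = q^n and
    v = (n-1-2a)/2 for n odd, Q = -q^(n/2) and v = n-1-2a for n even. As q^n and Q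
    are 1 modulo Phi_n, the difference of the two sides is, modulo Phi_n^2, an
    affine function of s. It vanishes exactly at s = 0, where x_s = y^(-a) and the
    sums terminate, by the q-Chu-Vandermonde identity, and likewise at s = d, where
    y / x_s = y^(-(n-1-a)). As d is invertible, it vanishes modulo Phi_n^2 at every
    s, in particular at s = m. *)

Require Import Defs.
From HB Require Import structures.
From mathcomp Require Import all_boot all_order all_algebra all_field.
From mathcomp Require Import ring zify.
Set Implicit Arguments. Unset Strict Implicit. Unset Printing Implicit Defensive.
Import Order.TTheory GRing.Theory Num.Theory.
Local Open Scope ring_scope.

(* [qpoch], over an arbitrary field. *)
Definition poch (F : fieldType) (x y : F) (k : nat) : F :=
  \prod_(i < k) (1 - x * y ^+ i).

(** * The q-Chu-Vandermonde identity and the exact transformation at x = y^(-N) *)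

Section QChuVandermonde.
Context (F : fieldType) (y : F).
Hypotheses (y_neq0 : y != 0) (y_notroot : forall j, 1 - y ^+ j.+1 != 0).
Implicit Types (x B C : F) (g : nat -> F).

Lemma poch0 x : poch x y 0 = 1.
Proof. by rewrite /poch big_ord0. Qed.

Lemma pochS x k : poch x y k.+1 = poch x y k * (1 - x * y ^+ k).
Proof. by rewrite /poch big_ord_recr. Qed.

Lemma pochD x j k : poch x y (j + k) = poch x y j * poch (x * y ^+ j) y k.
Proof.
elim: k => [|k IHk]; first by rewrite addn0 poch0 mulr1.
by rewrite addnS !pochS IHk -mulrA exprD (mulrA x).
Qed.

Lemma pochSl x k : poch x y k.+1 = (1 - x) * poch (x * y) y k.
Proof. by rewrite -add1n pochD pochS poch0 expr0 mulr1 mul1r expr1. Qed.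

Lemma poch_eq0 x k j : (j < k)%N -> x * y ^+ j = 1 -> poch x y k = 0.
Proof.
move=> ltjk xyj; apply/eqP/prodf_eq0; exists (Ordinal ltjk) => //=.
by rewrite xyj subrr.
Qed.

Lemma pochy_neq0 k : poch y y k != 0.
Proof. by apply/prodf_neq0 => i _; rewrite -exprS. Qed.

(* The coefficients of q-Chu-Vandermonde, equal to
   (-1)^i [N choose i] y^(C(i,2) - N i + i). *)
Definition vdmw N i : F := poch (y ^- N) y i * y ^+ i / poch y y i.

Lemma vdmw0 N : vdmw N 0 = 1.
Proof. by rewrite /vdmw !poch0 expr0 !mul1r invr1. Qed.

Lemma vdmw_gt N i : (N < i)%N -> vdmw N i = 0.
Proof.
move=> ltNi; rewrite /vdmw (poch_eq0 ltNi) ?mul0r //.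
by rewrite mulVf // expf_neq0.
Qed.

(** Peeling off the first factor of one symbol and the last of the other exposes the common
    [poch (y ^- N) y i]. This Pascal rule drives the induction on N in [qvandermonde]. *)
Lemma vdmwS N i : vdmw N.+1 i.+1 = vdmw N i.+1 - y ^- N * vdmw N i.
Proof.
have yN : y ^- N = y ^- N.+1 * y by rewrite exprS invfM mulrAC mulVf ?mul1r.
rewrite /vdmw yN pochSl (pochS y) (pochS (_ * y)) -exprS.
have := pochy_neq0 i; have := y_notroot i; rewrite !exprS.
set A := poch y y i; set P := poch _ y i; set t := (y * y ^+ N)^-1.
set u := y ^+ i => Hu HA.
by field; rewrite HA Hu.
Qed.

(** The terminating 2phi1 sum with argument y, cleared of its denominator [poch C y N]. The Pascal
    rule splits the sum for N+1 into the sum for N at (B, C), times 1 - C y^N, minus the one at (B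
    y, C y), times y^(-N) (1 - B). *)
Lemma qvandermonde N B C :
  \sum_(i < N.+1) vdmw N i * poch B y i * poch (C * y ^+ i) y (N - i) =
  \prod_(l < N) (B - C * y ^+ l).
Proof.
elim: N B C => [|N IHN] B C.
  by rewrite big_ord_recl !big_ord0 vdmw0 !poch0 !mulr1 addr0.
rewrite [RHS]big_ord_recr /= -IHN big_ord_recl vdmw0 poch0 subn0 expr0 !mulr1.
under eq_bigr => i _ do rewrite lift0 vdmwS !mulrBl subSS.
rewrite sumrB addrA.
(* The split-off term i = 0 rejoins the first half, whose top term vanishes since [vdmw N N.+1] is
   0. *)
pose T i := vdmw N i * poch B y i * poch (C * y ^+ i) y (N.+1 - i).
have -> : 1 * poch C y N.+1 + \sum_(i < N.+1) vdmw N i.+1 * poch B y i.+1 *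
    poch (C * y ^+ i.+1) y (N - i) = \sum_(i < N.+2) T i.
  by rewrite [RHS]big_ord_recl /T vdmw0 poch0 expr0 !mulr1 subn0.
rewrite big_ord_recr {2}/T vdmw_gt // !mul0r /= addr0.
have -> : \sum_(i < N.+1) T i = (\sum_(i < N.+1) vdmw N i * poch B y i *
    poch (C * y ^+ i) y (N - i)) * (1 - C * y ^+ N).
  rewrite mulr_suml; apply: eq_bigr => i _; have leiN : (i <= N)%N by rewrite -ltnS.
  rewrite /T subSn // pochS.
  by rewrite -(mulrA C) -exprD subnKC // !mulrA.
have -> : \sum_(i < N.+1) y ^- N * vdmw N i * poch B y i.+1 *
    poch (C * y ^+ i.+1) y (N - i) = y ^- N * (1 - B) *
    \sum_(i < N.+1) vdmw N i * poch (B * y) y i * poch (C * y * y ^+ i) y (N - i).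
  rewrite mulr_sumr; apply: eq_bigr => i _.
  by rewrite pochSl exprS -!mulrA; congr (_ * _); rewrite !mulrA; congr (_ * _ * _); ring.
rewrite !IHN.
have -> : \prod_(l < N) (B * y - C * y * y ^+ l) =
          y ^+ N * \prod_(l < N) (B - C * y ^+ l).
  rewrite -[in y ^+ N](card_ord N) -prodr_const -big_split /=.
  by apply: eq_bigr => i _; ring.
rewrite mulrACA mulrA mulVf ?expf_neq0 //; ring.
Qed.

(** The weight in the theorem's sums, at y = q^d and x = q^r. Replacing x by y / x only swaps its
    two numerator factors. *)
Definition pochq2 x k : F := poch x y k * poch (y / x) y k / poch y y k ^+ 2.

(* [qbinom], over an arbitrary field. *)
Definition gbin k j : F := poch (y ^+ (k - j).+1) y j / poch y y j.

Lemma gbinE k j : (j <= k)%N -> gbin k j = poch y y k / (poch y y j * poch y y (k - j)).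
Proof.
move=> lejk; rewrite /gbin; have := pochD y (k - j) j.
rewrite subnK // -exprS => ->.
by field; rewrite !pochy_neq0.
Qed.

Lemma bin2D m n : 'C(m + n, 2) = ('C(m, 2) + 'C(n, 2) + m * n)%N.
Proof.
elim: n => [|n IHn]; first by rewrite addn0 bin0n muln0 !addn0.
by rewrite addnS !binS !bin1 IHn; lia.
Qed.

(** Each factor is -y^l (1 - y^(N-l)), and the 1 - y^(N-l) are the last M factors of
    [poch y y N]. *)
Lemma poch_reflect N M : (M <= N)%N ->
  \prod_(l < M) (y ^+ N - y ^+ l) =
  (-1) ^+ M * y ^+ 'C(M, 2) * (poch y y N / poch y y (N - M)).
Proof.
move=> leMN; elim: M leMN => [|M IHM] ltMN.
  by rewrite big_ord0 bin0n subn0 divff ?pochy_neq0 // !mulr1.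
rewrite big_ord_recr /= IHM 1?ltnW // binS bin1 exprD exprS.
have -> : poch y y (N - M) = poch y y (N - M.+1) * (1 - y ^+ (N - M)).
  have -> : (N - M = (N - M.+1).+1)%N by lia.
  by rewrite pochS -exprS.
have -> : y ^+ N = y ^+ M * y ^+ (N - M) by rewrite -exprD subnKC // ltnW.
have := pochy_neq0 (N - M.+1); have: 1 - y ^+ (N - M) != 0.
  by have -> : (N - M = (N - M.+1).+1)%N by lia.
move=> h1 h2; field; by rewrite h1 h2.
Qed.

(** The inner sum left once the double sum in [transform_exact] is exchanged. With k = i + j it is a
    multiple of the q-Chu-Vandermonde sum of order M = N - j at B = y^(N+1+j), C = y^(j+1). *)
Lemma pochq2_gbin_sum N n j : (N < n)%N -> (j <= N)%N ->
  \sum_(j <= k < n) pochq2 (y ^- N) k * y ^+ k * gbin k j =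
  pochq2 (y ^- N) j * y ^+ j * ((-1) ^+ (N - j) * y ^+ (j.+1 * (N - j) + 'C(N - j, 2))).
Proof.
move=> ltNn lejN; rewrite (@big_cat_nat _ _ _ N.+1) //= ?ltnS //; last exact: leqW.
(* For k > N, [poch (y ^- N) y k] contains the factor 1 - y^(-N) y^N = 0. *)
rewrite [X in _ + X]big_nat_cond [X in _ + X]big1 ?addr0; last first.
  move=> k /andP[/andP[ltNk _] _].
  by rewrite /pochq2 (poch_eq0 ltNk) ?mul0r // mulVf // expf_neq0.
set M := (N - j)%N.
rewrite -{1}[j]add0n big_addn -/M subSn // -/M big_mkord.
pose pref := poch (y ^- N) y j * poch (y ^+ N.+1) y j / poch y y j * y ^+ j.
have yN : y / y ^- N = y ^+ N.+1 by rewrite invrK exprS.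
have -> : pochq2 (y ^- N) j * y ^+ j = pref / poch y y j.
  by rewrite /pochq2 yN /pref; field; rewrite pochy_neq0.
rewrite (eq_bigr (fun i : 'I_M.+1 => pref / poch y y N *
   (vdmw M i * poch (y ^+ (N.+1 + j)) y i * poch (y ^+ j.+1 * y ^+ i) y (M - i)))); last first.
  move=> i _; rewrite gbinE ?leq_addl // addnK [(i + j)%N]addnC /pochq2 yN /vdmw /pref.
  have -> : poch y y N = poch y y (j + i) * poch (y ^+ j.+1 * y ^+ i) y (M - i).
    rewrite -exprD addSn exprS -pochD; congr poch; have := ltn_ord i; rewrite /M; lia.
  rewrite (pochD (y ^- N)) (pochD (y ^+ N.+1)) -(exprD y N.+1 j).
  have -> : y ^- N * y ^+ j = y ^- M.
    by rewrite -(subnKC lejN) exprD invfM mulrAC mulVf ?mul1r // expf_neq0.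
  have hM : poch (y ^+ j.+1 * y ^+ i) y (M - i) != 0.
    apply/prodf_neq0 => l _; rewrite -!exprD addSn addSn; exact: y_notroot.
  rewrite (exprD y j i).
  have := pochy_neq0 (j + i); have := pochy_neq0 j; have := pochy_neq0 i; move: hM.
  move: (poch (y ^+ j.+1 * _) _ _) (poch (y ^- M) _ _) (poch (y ^+ (_ + _)) _ _).
  move: (poch y y i) (poch y y j) (poch y y (j + i)) => p1 p2 p3 p4 p5 p6 h4 h1 h2 h3.
  by field; rewrite h1 h2 h3 h4.
rewrite -mulr_sumr qvandermonde.
have -> : \prod_(l < M) (y ^+ (N.+1 + j) - y ^+ j.+1 * y ^+ l) =
   y ^+ (j.+1 * M) * \prod_(l < M) (y ^+ N - y ^+ l).
  have -> : y ^+ (j.+1 * M) = \prod_(l < M) y ^+ j.+1.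
    by rewrite prodr_const card_ord exprM.
  rewrite -big_split /=.
  by apply: eq_bigr => l _; rewrite mulrBr -!exprD !addSn addnC.
rewrite poch_reflect ?leq_subr // /M subKn // -/M exprD.
by field; rewrite !pochy_neq0.
Qed.

(** Exchanging the double sum leaves one comparison for each g_j. For j > N both sides vanish; for j
    <= N the powers of y agree because C(N+1,2) = C(j+1,2) + (j+1)(N-j) + C(N-j,2). *)
Lemma transform_exact N n g : (N < n)%N ->
  y ^+ 'C(N.+1, 2) * \sum_(0 <= k < n) pochq2 (y ^- N) k * y ^+ k * g k =
  (-1) ^+ N * \sum_(0 <= k < n) pochq2 (y ^- N) k * y ^+ k *
     \sum_(0 <= j < k.+1) (-1) ^+ j * y ^+ 'C(j.+1, 2) * gbin k j * g j.
Proof.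
move=> ltNn.
have -> : \sum_(0 <= k < n) pochq2 (y ^- N) k * y ^+ k *
     \sum_(0 <= j < k.+1) (-1) ^+ j * y ^+ 'C(j.+1, 2) * gbin k j * g j =
   \sum_(0 <= j < n) (-1) ^+ j * y ^+ 'C(j.+1, 2) * g j *
     \sum_(j <= k < n) pochq2 (y ^- N) k * y ^+ k * gbin k j.
  under eq_big_nat => k /andP[_ ltkn] do rewrite mulr_sumr (big_nat_widen _ _ n) //=.
  rewrite (exchange_big_dep_nat xpredT) //=; apply: eq_bigr => j _.
  rewrite mulr_sumr [RHS](big_nat_widenl _ 0) //=.
  by apply: eq_bigr => k _; ring.
rewrite !mulr_sumr; apply: eq_big_nat => j /andP[_ ltjn].
case: (leqP j N) => [lejN | ltNj]; last first.
  have D0 k : (N < k)%N -> pochq2 (y ^- N) k = 0.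
    by move=> ltNk; rewrite /pochq2 (poch_eq0 ltNk) ?mul0r // mulVf // expf_neq0.
  rewrite D0 // !mul0r mulr0 big_nat_cond big1 ?mulr0 // => k /andP[/andP[lejk _] _].
  by rewrite D0 ?mul0r // (leq_trans ltNj).
rewrite pochq2_gbin_sum //.
have -> : 'C(N.+1, 2) = ('C(j.+1, 2) + (j.+1 * (N - j) + 'C(N - j, 2)))%N.
  by rewrite -{1}(subnKC lejN) -addSn bin2D; lia.
have -> : (-1) ^+ (N - j) = (-1) ^+ N * (-1) ^+ j :> F.
  by rewrite -[in RHS](subnK lejN) exprD -mulrA -expr2 sqrr_sign mulr1.
(* The signs become variables u, v with square 1; inserting these squares on the left makes the
   identity polynomial. *)
rewrite exprD; have : ((-1) ^+ j) ^+ 2 = 1 :> F by rewrite sqrr_sign.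
have : ((-1) ^+ N) ^+ 2 = 1 :> F by rewrite sqrr_sign.
move: ((-1) ^+ j) ((-1) ^+ N) (g j) (y ^+ 'C(j.+1, 2)) (y ^+ (_ + _)) => u v w e1 e2 hv hu.
by rewrite -[LHS]mul1r -{1}hv -[LHS]mul1r -{1}hu; ring.
Qed.

End QChuVandermonde.

(** * The embedding of Z[q] into its fraction field *)

Lemma polyF_eq0 p : (polyF p == 0) = (p == 0).
Proof. exact: tofrac_eq0. Qed.

Lemma polyFM p1 p2 : polyF (p1 * p2) = polyF p1 * polyF p2.
Proof. exact: tofracM. Qed.

Lemma polyFD p1 p2 : polyF (p1 + p2) = polyF p1 + polyF p2.
Proof. exact: tofracD. Qed.

Lemma polyFN p : polyF (- p) = - polyF p.
Proof. exact: tofracN. Qed.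

Lemma polyF1 : polyF 1 = 1.
Proof. exact: tofrac1. Qed.

Lemma polyFX p k : polyF (p ^+ k) = polyF p ^+ k.
Proof. exact: tofracXn. Qed.

Lemma polyF_int (s : int) : polyF s%:~R = s%:~R.
Proof. exact: (rmorph_int (@FracField.tofrac {poly int})). Qed.

(** The downward induction step of [aff_exp], with u standing for x^(-m). *)
Lemma divr_sub1_step (K : fieldType) (x u m : K) : x != 0 ->
  u / x - 1 - (- m - 1) * (x - 1) =
  x^-1 * ((u - 1 - (- m) * (x - 1)) + (m + 1) * ((x - 1) * (x - 1))).
Proof. by move=> x0; field. Qed.

(** * Localization at Phi, and functions affine modulo the second ideal *)

Section LocalIdeals.
Context (Phi : {poly int}).

(* The k-th power of the maximal ideal of the localization of Z[q] at Phi; the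
   nonzero integers are invertible, since [coprimep] ignores constants. *)
Definition idl k (x : ratfun) : Prop :=
  exists P Q : {poly int},
    Q != 0 /\ coprimep Q Phi /\ x = polyF (Phi ^+ k * P) / polyF Q.

Lemma idlP k p : idl k (polyF (Phi ^+ k * p)).
Proof.
exists p, 1; rewrite oner_neq0 coprime1p; split=> //; split=> //.
by rewrite polyF1 divr1.
Qed.

Lemma idl0P p : idl 0 (polyF p).
Proof. by have := idlP 0 p; rewrite expr0 mul1r. Qed.

Lemma idl0_1 : idl 0 1.
Proof. by rewrite -polyF1; apply: idl0P. Qed.

Lemma idl_0 k : idl k 0.
Proof. by have := idlP k 0; rewrite mulr0 /polyF tofrac0. Qed.

Lemma idl_int (s : int) : idl 0 s%:~R.
Proof. by rewrite -polyF_int; apply: idl0P. Qed.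

Lemma idlV p : p != 0 -> coprimep p Phi -> idl 0 (polyF p)^-1.
Proof.
by move=> p0 cp; exists 1, p; rewrite expr0 mul1r polyF1 mul1r.
Qed.

Lemma idlD k x1 x2 : idl k x1 -> idl k x2 -> idl k (x1 + x2).
Proof.
move=> [P1 [Q1 [n1 [c1 ->]]]] [P2 [Q2 [n2 [c2 ->]]]].
exists (P1 * Q2 + P2 * Q1), (Q1 * Q2).
rewrite mulf_neq0 // coprimepMl c1; split=> //; split=> //.
rewrite addf_div ?polyF_eq0 // -!polyFM -polyFD; congr (polyF _ / _); ring.
Qed.

Lemma idlN k x : idl k x -> idl k (- x).
Proof.
move=> [P [Q [n1 [c1 ->]]]]; exists (- P), Q; do 2!split=> //.
by rewrite mulrN polyFN mulNr.
Qed.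

Lemma idlB k x1 x2 : idl k x1 -> idl k x2 -> idl k (x1 - x2).
Proof. by move=> h1 h2; apply: idlD => //; apply: idlN. Qed.

Lemma idlM i j x1 x2 : idl i x1 -> idl j x2 -> idl (i + j) (x1 * x2).
Proof.
move=> [P1 [Q1 [n1 [c1 ->]]]] [P2 [Q2 [n2 [c2 ->]]]].
exists (P1 * P2), (Q1 * Q2).
rewrite mulf_neq0 // coprimepMl c1; split=> //; split=> //.
by rewrite mulf_div -!polyFM exprD mulrACA.
Qed.

Lemma idlW i j x : idl (i + j) x -> idl i x.
Proof.
move=> [P [Q [n1 [c1 ->]]]]; exists (Phi ^+ j * P), Q; do 2!split=> //.
by rewrite exprD mulrA.
Qed.

Lemma idl_sum k (T : Type) (s : seq T) (G : T -> ratfun) :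
  (forall i, idl k (G i)) -> idl k (\sum_(i <- s) G i).
Proof.
move=> hG; apply: big_ind => //; first exact: idl_0.
by move=> x1 x2; apply: idlD.
Qed.

Lemma idl_prod (T : Type) (s : seq T) (G : T -> ratfun) :
  (forall i, idl 0 (G i)) -> idl 0 (\prod_(i <- s) G i).
Proof.
by move=> hG; apply: big_ind => //; [apply: idl0_1 | move=> x1 x2; apply: idlM].
Qed.

(** Over Z, [%|] is divisibility up to a nonzero integer c, which serves as the denominator. *)
Lemma idl_dvd p : Phi %| p -> idl 1 (polyF p).
Proof.
case/Pdiv.WeakIdomain.dvdpP=> -[c e] /= c0 E; exists e, c%:P.
have c0' : c%:P != 0 by rewrite polyC_eq0.
split=> //; split; first by rewrite -alg_polyC coprimepZl // coprime1p.
apply: (canRL (mulfK _)); rewrite ?polyF_eq0 // -polyFM.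
by rewrite mulrC mul_polyC E expr1 mulrC.
Qed.

(* A(s) is affine in s modulo the second ideal, with slope in the first. *)
Definition aff (A : int -> ratfun) : Prop :=
  exists2 D, idl 1 D & idl 0 (A 0) /\ forall s : int, idl 2 (A s - A 0 - s%:~R * D).

Lemma eq_aff (A B : int -> ratfun) : A =1 B -> aff A -> aff B.
Proof.
move=> AB [D ID [A0 A2]]; exists D => //; rewrite -AB; split=> // s.
by rewrite -AB.
Qed.

Lemma aff_idl0 A s : aff A -> idl 0 (A s).
Proof.
case=> D ID [I0 /(_ s) I2].
have -> : A s = (A s - A 0 - s%:~R * D) + (A 0 + s%:~R * D) by ring.
apply: idlD; first exact: (@idlW 0 2).
apply: idlD => //; apply: (@idlM 0 0); [exact: idl_int | exact: (@idlW 0 1)].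
Qed.

Lemma aff_cst c : idl 0 c -> aff (fun=> c).
Proof.
move=> Ic; exists 0; first exact: idl_0.
by split=> // s; rewrite mulr0 subr0 subrr; apply: idl_0.
Qed.

Lemma affD A B : aff A -> aff B -> aff (fun s => A s + B s).
Proof.
case=> D ID [A0 A2] [E IE [B0 B2]]; exists (D + E); first exact: idlD.
split=> [|s]; first exact: idlD.
have -> : A s + B s - (A 0 + B 0) - s%:~R * (D + E) =
  (A s - A 0 - s%:~R * D) + (B s - B 0 - s%:~R * E) by ring.
exact: idlD.
Qed.

(** The slope follows the product rule; the cross term s^2 D E lies in the second ideal, D and E
    being in the first. *)
Lemma affM A B : aff A -> aff B -> aff (fun s => A s * B s).
Proof.
move=> affA affB; have Bs := fun s => aff_idl0 s affB.
case: affA affB => D ID [A0 A2] [E IE [B0 B2]].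
exists (A 0 * E + D * B 0).
  by apply: idlD; [apply: (@idlM 0 1) | apply: (@idlM 1 0)].
split=> [|s]; first exact: (@idlM 0 0).
have -> : A s * B s - A 0 * B 0 - s%:~R * (A 0 * E + D * B 0) =
  A 0 * (B s - B 0 - s%:~R * E) + (A s - A 0 - s%:~R * D) * B s
  + s%:~R * (D * ((B s - B 0 - s%:~R * E) + s%:~R * E)) by ring.
apply: idlD; first by apply: idlD; [apply: (@idlM 0 2) | apply: (@idlM 2 0)].
apply: (@idlM 0 2); first exact: idl_int.
apply: (@idlM 1 1) => //; apply: idlD; first exact: (@idlW 1 1).
by apply: (@idlM 0 1) => //; apply: idl_int.
Qed.

Lemma aff_sum (T : Type) (s : seq T) (G : T -> int -> ratfun) :
  (forall i, aff (G i)) -> aff (fun m => \sum_(i <- s) G i m).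
Proof.
move=> hG; elim: s => [|i s IHs].
  have [D ID H] := aff_cst (idl_0 0); exists D => //.
  by rewrite !big_nil; case: H => ? H; split=> // m; rewrite !big_nil; apply: H.
have [D ID H] := affD (hG i) IHs; exists D => //.
by rewrite !big_cons; case: H => ? H; split=> // m; rewrite !big_cons; apply: H.
Qed.

Lemma aff_prod (T : Type) (s : seq T) (G : T -> int -> ratfun) :
  (forall i, aff (G i)) -> aff (fun m => \prod_(i <- s) G i m).
Proof.
move=> hG; elim: s => [|i s IHs].
  have [D ID H] := aff_cst idl0_1; exists D => //.
  by rewrite !big_nil; case: H => ? H; split=> // m; rewrite !big_nil; apply: H.
have [D ID H] := affM (hG i) IHs; exists D => //.
by rewrite !big_cons; case: H => ? H; split=> // m; rewrite !big_cons; apply: H.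
Qed.

Lemma affZ A (v : int) : aff A -> aff (fun s => A (v * s)).
Proof.
case=> D ID [A0 A2]; exists (v%:~R * D).
  by apply: (@idlM 0 1) => //; apply: idl_int.
rewrite mulr0; split=> // s; have := A2 (v * s).
by rewrite intrM mulrA [v%:~R * s%:~R]mulrC.
Qed.

(** To first order x^s is 1 + s (x - 1); upward and downward induction keep the error a multiple of
    (x - 1)^2. *)
Lemma aff_exp x : x != 0 -> idl 1 (x - 1) -> idl 0 x^-1 -> aff (fun s => x ^ s).
Proof.
move=> x0 I1 IV; exists (x - 1) => //; rewrite expr0z; split; first exact: idl0_1.
have I11 := idlM I1 I1.
have I0x : idl 0 x.
  by rewrite -(subrK 1 x); apply: idlD; [exact: (@idlW 0 1) | exact: idl0_1].
elim/int_rect => [|m IHm|m IHm].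
- by rewrite expr0z subrr mul0r subr0; apply: idl_0.
- have -> : x ^ m.+1%:Z - 1 - m.+1%:~R * (x - 1) =
    x * (x ^ m%:Z - 1 - m%:~R * (x - 1)) + m%:~R * ((x - 1) * (x - 1)).
    rewrite -addn1 PoszD expfzDr // expr1z intrD; ring.
  by apply: idlD; [apply: (@idlM 0 2) | apply: (@idlM 0 2) => //; apply: idl_int].
- have -> : x ^ (- m.+1%:Z) - 1 - (- m.+1%:Z)%:~R * (x - 1) =
    x^-1 * ((x ^ (- m%:Z) - 1 - (- m%:Z)%:~R * (x - 1))
       + (m.+1%:Z)%:~R * ((x - 1) * (x - 1))).
    have -> : - m.+1%:Z = - m%:Z - 1 by lia.
    have -> : m.+1%:Z = m%:Z + 1 by lia.
    rewrite expfzDr // exprN1 !intrD !intrN.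
    exact: divr_sub1_step.
  apply: (@idlM 0 2) => //.
  by apply: idlD => //; apply: (@idlM 0 2) => //; apply: idl_int.
Qed.

(** Eliminating the slope between s = m and s = d writes d A(m) as a combination of two error terms,
    and the integer d is invertible. *)
Lemma aff_interp A (d m : int) : d != 0 -> aff A -> A 0 = 0 -> A d = 0 -> idl 2 (A m).
Proof.
move=> d0 [D ID [_ A2]] A0 Ad.
have dZ : (d%:~R : {poly int}) = d%:P by rewrite -[d in RHS]intz rmorph_int.
have cop : coprimep d%:~R Phi by rewrite dZ -alg_polyC coprimepZl // coprime1p.
have dP : d%:~R != 0 :> {poly int} by rewrite dZ polyC_eq0.
have dF : d%:~R != 0 :> ratfun by rewrite -polyF_int polyF_eq0.
have -> : A m = (polyF d%:~R)^-1 * (d%:~R * (A m - A 0 - m%:~R * D) -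
    m%:~R * (A d - A 0 - d%:~R * D)).
  by rewrite Ad A0 polyF_int; apply: (canRL (mulKf dF)); ring.
apply: (@idlM 0 2); first exact: idlV.
by apply: idlB; apply: (@idlM 0 2) => //; apply: idl_int.
Qed.

End LocalIdeals.

(** * Coprimality and divisibility for cyclotomic polynomials *)

Lemma coprimep_Cyclotomic n (p : {poly int}) :
  (forall z : algC, n.-primitive_root z -> (map_poly intr p).[z] != 0) ->
  coprimep p 'Phi_n.
Proof.
move=> pz; rewrite coprimep_def; apply: contraT => szg.
have dvd_root (e : {poly int}) (z : algC) : gcdp p 'Phi_n %| e ->
    root (map_poly intr (gcdp p 'Phi_n)) z -> root (map_poly intr e) z.
  case/Pdiv.WeakIdomain.dvdpP=> -[c u] /= c0 E gz.
  have : root (c%:~R *: map_poly intr e) z.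
    by rewrite -map_polyZ E rmorphM rootM gz orbT.
  by rewrite rootZ // intr_eq0.
(* A nonconstant gcd has a root in [algC]: a primitive n-th root of unity, as it is a root of
   ['Phi_n], and also a root of p. *)
have : size (map_poly (intr : int -> algC) (gcdp p 'Phi_n)) != 1%N.
  by rewrite size_map_inj_poly //; apply: intr_inj.
case/closed_rootP=> z gz.
have := dvd_root _ z (dvdp_gcdr _ _) gz.
(* For n = 0 the polynomial ['Phi_0] is 1, which has no root. *)
have [->|n_gt0] := posnP n.
  by rewrite Cyclotomic0 rmorph1 (negbTE (root1 _)).
have [w wn] := C_prim_root_exists n_gt0.
rewrite (Cintr_Cyclotomic wn) root_cyclotomic // => zn.
by have := dvd_root _ z (dvdp_gcdl _ _) gz; rewrite /root (negbTE (pz z zn)).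
Qed.

Lemma coprimep_1subXn_Cyclotomic n k : ~~ (n %| k)%N -> coprimep (1 - 'X^k) 'Phi_n.
Proof.
move=> nk; apply: coprimep_Cyclotomic => z zn.
rewrite rmorphB rmorph1 /= map_polyXn !hornerE subr_eq0 eq_sym.
by rewrite -(prim_order_dvd zn).
Qed.

Lemma coprimep_X_Cyclotomic n : (0 < n)%N -> coprimep 'X 'Phi_n.
Proof.
move=> n_gt0; apply: coprimep_Cyclotomic => z zn.
rewrite map_polyX hornerX; apply/eqP=> z0; have := prim_expr_order zn.
by rewrite z0 expr0n gtn_eqF // => /eqP; rewrite eq_sym oner_eq0.
Qed.

Lemma Cyclotomic_dvd_Xn_sub1 n : (0 < n)%N -> 'Phi_n %| 'X^n - 1.
Proof.
move=> n_gt0; rewrite -(prod_Cyclotomic n_gt0) (bigD1_seq n) ?divisors_uniq //=.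
  exact: dvdp_mulr.
by rewrite -dvdn_divisors.
Qed.

(** ['Phi_(2 * h)] divides (X^h - 1)(X^h + 1) and is coprime to the first factor. Hence -q^h is 1
    modulo it, as needed for n = 2h. *)
Lemma Cyclotomic_dvd_Xn_add1 h : (0 < h)%N -> 'Phi_(2 * h) %| 'X^h + 1.
Proof.
move=> h_gt0; have := @Cyclotomic_dvd_Xn_sub1 (2 * h).
have -> : 'X^(2 * h) - 1 = (1 - 'X^h) * (- ('X^h + 1)) :> {poly int}.
  by rewrite mulnC exprM; ring.
rewrite Gauss_dvdpr ?dvdpNr; first by apply; lia.
by rewrite coprimep_sym coprimep_1subXn_Cyclotomic // gtnNdvd; lia.
Qed.

(** * Integrality at Phi_n, and the sums as functions of x *)

Section Localization.
Context (n : nat).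
Hypothesis n_gt0 : (0 < n)%N.
Local Notation I := (idl 'Phi_n).

Lemma qF_neq0 : qF != 0.
Proof. by rewrite polyF_eq0 polyX_eq0. Qed.

Lemma idl0M x1 x2 : I 0 x1 -> I 0 x2 -> I 0 (x1 * x2).
Proof. exact: (@idlM _ 0 0). Qed.

Lemma idl0X x k : I 0 x -> I 0 (x ^+ k).
Proof.
move=> Ix; elim: k => [|k IHk]; first by rewrite expr0; apply: idl0_1.
by rewrite exprS; apply: idl0M.
Qed.

Lemma idl_qF : I 0 qF. Proof. exact: idl0P. Qed.

Lemma idl_qFV : I 0 qF^-1.
Proof. by apply: idlV; rewrite ?polyX_eq0 // coprimep_X_Cyclotomic. Qed.

Lemma idl_sign k : I 0 ((-1) ^+ k).
Proof. by apply: idl0X; apply: idlN; apply: idl0_1. Qed.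

Lemma idl_qFn_sub1 : I 1 (qF ^+ n - 1).
Proof.
by rewrite -polyFX -polyF1 -polyFN -polyFD; apply/idl_dvd/Cyclotomic_dvd_Xn_sub1.
Qed.

Lemma idl_peval f x : I 0 x -> I 0 (peval f x).
Proof.
move=> Ix; rewrite /peval horner_coef; apply: idl_sum => i.
rewrite coef_map_id0 //; apply: idl0M; [exact: idl_int | exact: idl0X].
Qed.

Lemma idl_poch x y k : I 0 x -> I 0 y -> I 0 (qpoch x y k).
Proof.
move=> Ix Iy; apply: idl_prod => i; apply: idlB; first exact: idl0_1.
by apply: idl0M => //; apply: idl0X.
Qed.

Section Base.
Context (d : nat).
Hypotheses (d_gt0 : (0 < d)%N) (nd : coprime n d).
Local Notation y := (qF ^+ d).

Lemma qFd_notroot j : 1 - y ^+ j.+1 != 0.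
Proof.
rewrite -exprM -polyFX -polyF1 -polyFN -polyFD polyF_eq0 subr_eq0.
rewrite eq_sym -subr_eq0 -size_poly_eq0 size_XnsubC //; lia.
Qed.

(** As n is coprime to d, it divides d (j+1) only if it divides j+1. *)
Lemma idl_1sub_qFdV j : (j.+1 < n)%N -> I 0 (1 - y ^+ j.+1)^-1.
Proof.
move=> ltjn; have := qFd_notroot j.
rewrite -exprM -polyFX -polyF1 -polyFN -polyFD polyF_eq0 => nz.
apply: idlV => //; apply: coprimep_1subXn_Cyclotomic.
by rewrite Gauss_dvdr // gtnNdvd.
Qed.

Lemma idl_pochV k : (k < n)%N -> I 0 (qpoch y y k)^-1.
Proof.
move=> ltkn; rewrite /qpoch -prodfV; apply: idl_prod => i.
by rewrite -exprS; apply: idl_1sub_qFdV; have := ltn_ord i; lia.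
Qed.

Lemma idl_qFd : I 0 y. Proof. exact/idl0X/idl_qF. Qed.

Lemma idl_qFdV : I 0 y^-1. Proof. by rewrite -exprVn; apply/idl0X/idl_qFV. Qed.

Lemma idl_fhat f k : (k < n)%N -> I 0 (fhat f y k).
Proof.
move=> ltkn; rewrite /fhat big_mkord; apply: idl_sum => i.
have Iy := idl_qFd; apply: idl0M; last exact: idl_peval.
apply: idl0M; first by apply: idl0M; [exact: idl_sign | exact: idl0X].
apply: idl0M; first by apply: idl_poch => //; apply: idl0X.
by apply: idl_pochV; have := ltn_ord i; lia.
Qed.

(** The sum of the theorem with q^r freed to a variable x, which can then run through y^(-a) q^(n
    s). *)
Definition wsum (g : nat -> ratfun) (x : ratfun) : ratfun :=
  \sum_(0 <= k < n) pochq2 y x k * y ^+ k * g k.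

Lemma wsum_sym g x : wsum g (y / x) = wsum g x.
Proof.
apply: eq_bigr => k _; rewrite /pochq2 divKf ?expf_neq0 ?qF_neq0 //.
by congr (_ / _ * _ * _); rewrite mulrC.
Qed.

Lemma wsum_fhat f N : (N < n)%N ->
  y ^+ 'C(N.+1, 2) * wsum (fun k => peval (f k) y) (y ^- N) =
  (-1) ^+ N * wsum (fhat f y) (y ^- N).
Proof.
by move=> ltNn; apply: transform_exact => //; [rewrite expf_neq0 ?qF_neq0 | exact: qFd_notroot].
Qed.

Lemma aff_qpoch (A : int -> ratfun) k : aff 'Phi_n A -> aff 'Phi_n (fun s => qpoch (A s) y k).
Proof.
move=> affA; apply: aff_prod => i; apply: affD; first exact/aff_cst/idl0_1.
apply: (@eq_aff _ (fun s => -1 * (A s * y ^+ i))) => [s|]; first by rewrite mulN1r.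
apply: affM; first by apply/aff_cst/idlN/idl0_1.
by apply: affM => //; apply/aff_cst/idl0X/idl_qFd.
Qed.

Lemma aff_qFn : aff 'Phi_n (fun s => (qF ^+ n) ^ s).
Proof.
apply: aff_exp; first by rewrite expf_neq0 ?qF_neq0.
  exact: idl_qFn_sub1.
by rewrite -exprVn; apply/idl0X/idl_qFV.
Qed.

Lemma aff_wsum g a : (forall k, (k < n)%N -> I 0 (g k)) ->
  aff 'Phi_n (fun s => wsum g (y ^- a * (qF ^+ n) ^ s)).
Proof.
move=> Ig; apply: (@eq_aff _ (fun s => \sum_(k < n)
    qpoch (y ^- a * (qF ^+ n) ^ s) y k * qpoch (y ^+ a.+1 * (qF ^+ n) ^ (-1 * s)) y k *
    ((qpoch y y k)^-1 ^+ 2 * y ^+ k * g k))) => [s|].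
  rewrite /wsum big_mkord; apply: eq_bigr => k _; rewrite /pochq2.
  (* The exponent -s is written [-1 * s] so that [affZ] applies. *)
  have -> : y / (y ^- a * (qF ^+ n) ^ s) = y ^+ a.+1 * (qF ^+ n) ^ (-1 * s).
    by rewrite invfM invrK mulN1r invr_expz mulrA -exprS.
  by rewrite exprVn !mulrA.
apply: aff_sum => k; apply: affM.
  apply: affM; apply: aff_qpoch; apply: affM.
  - by apply: aff_cst; rewrite -exprVn; apply/idl0X/idl_qFdV.
  - exact: aff_qFn.
  - exact/aff_cst/idl0X/idl_qFd.
  - exact/affZ/aff_qFn.
apply: aff_cst; apply: idl0M; last exact: Ig.
by apply: idl0M; apply: idl0X; [exact: idl_pochV | exact: idl_qFd].
Qed.

End Base.
End Localization.

(* The hypothesis on [Q ^ (v * d)] makes the difference vanish at m = d, where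
   the q-Chu-Vandermonde identity applies with n - 1 - a in place of a. *)
Lemma wsum_congr n d a (f : nat -> {poly int}) (Q : ratfun) (v m : int) :
  (0 < n)%N -> (0 < d)%N -> coprime n d -> (a < n)%N ->
  Q != 0 -> idl 'Phi_n 1 (Q - 1) -> idl 'Phi_n 0 Q^-1 ->
  let y := qF ^+ d in let x := y ^- a * (qF ^+ n) ^ m in
  y ^+ 'C(a.+1, 2) * Q ^ (v * d) =
    (-1) ^+ (a + (n.-1 - a)) * y ^+ 'C((n.-1 - a).+1, 2) ->
  idl 'Phi_n 2 (y ^+ 'C(a.+1, 2) * Q ^ (v * m) * wsum n d (fun k => peval (f k) y) x
     - (-1) ^+ a * wsum n d (fhat f y) x).
Proof.
move=> n0 d0 nd ltan Q0 Q1 QV y x Qd.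
have Iy := idl_qFd n d.
pose W g s := wsum n d g (y ^- a * (qF ^+ n) ^ s).
apply: (@aff_interp _ (fun s => y ^+ 'C(a.+1, 2) * Q ^ (v * s) * W (fun k => peval (f k) y) s
  - (-1) ^+ a * W (fhat f y) s) d).
- by rewrite -lt0n.
- apply: affD.
    apply: affM; last by apply: aff_wsum => // k _; apply: idl_peval.
    apply: affM; first exact/aff_cst/idl0X.
    exact/affZ/aff_exp.
  apply: (@eq_aff _ (fun s => - (-1) ^+ a * W (fhat f y) s)) => [s|].
    by rewrite mulNr.
  apply: affM; first exact/aff_cst/idlN/idl_sign.
  by apply: aff_wsum => // k; apply: idl_fhat.
- rewrite /W mulr0 !expr0z !mulr1; apply/eqP; rewrite subr_eq0; apply/eqP.
  exact: wsum_fhat.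
(* Here q^(n d) = y^n, so x_d = y^(n-a) = y / y^(-(n-1-a)), and the symmetry in x and y / x gives a
   terminating sum again. *)
- have xd : y ^- a * (qF ^+ n) ^ d = y / y ^- (n.-1 - a).
    have y0 : y != 0 by rewrite expf_neq0 ?qF_neq0.
    have -> : (qF ^+ n) ^ d = y ^+ n by rewrite -exprnP -!exprM mulnC.
    rewrite invrK -exprS; apply: (canLR (mulKf _)); first by rewrite expf_neq0.
    by rewrite -exprD; congr (_ ^+ _); lia.
  rewrite /W xd !wsum_sym Qd -mulrA wsum_fhat //; last by lia.
  by rewrite mulrA exprD -[_ * _ * (-1) ^+ _]mulrA -expr2 sqrr_sign mulr1 subrr.
Qed.

(** * The powers of q matching the two interpolation points *)

Lemma bin2S_double k : (2 * 'C(k.+1, 2) = k * k.+1)%N.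
Proof. by elim: k => // k IHk; rewrite binS bin1 mulnDr IHk; lia. Qed.

(** With n = 2h+1, C(n-a,2) - C(a+1,2) = n (h-a), and the sign (-1)^(n-1) is 1. *)
Lemma weight_odd h a d : (a <= h.*2)%N ->
  let y := qF ^+ d in
  y ^+ 'C(a.+1, 2) * (qF ^+ h.*2.+1) ^ ((h%:Z - a%:Z) * d) =
  (-1) ^+ (a + (h.*2 - a)) * y ^+ 'C((h.*2 - a).+1, 2).
Proof.
move=> leah y; rewrite subnKC // -signr_odd odd_double mul1r.
rewrite /y -!exprM !exprnP exprz_exp -expfzDr ?qF_neq0 //; congr (_ ^ _).
have := bin2S_double a; have := bin2S_double (h.*2 - a).
nia.
Qed.

Lemma exprz_sign_odd (K : fieldType) (t : int) : (-1) ^ (2 * t + 1) = -1 :> K.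
Proof.
have m1 : -1 != 0 :> K by rewrite oppr_eq0 oner_eq0.
by rewrite expfzDr // expr1z -exprz_exp -exprnP sqrrN expr1n exp1rz mul1r.
Qed.

(** With n = 2h and v = n-1-2a, C(n-a,2) - C(a+1,2) = h v. The sign (-1)^(n-1) = -1 comes from the
    base -q^h, since v d is odd. *)
Lemma weight_even h a d : (a < h.*2)%N -> odd d ->
  let y := qF ^+ d in
  y ^+ 'C(a.+1, 2) * (- qF ^+ h) ^ ((h.*2%:Z - 1 - 2 * a%:Z) * d) =
  (-1) ^+ (a + (h.*2.-1 - a)) * y ^+ 'C((h.*2.-1 - a).+1, 2).
Proof.
move=> leah od y; rewrite subnKC; last by lia.
have -> : (-1) ^+ h.*2.-1 = -1 :> ratfun.
  by rewrite -signr_odd; have -> : odd h.*2.-1 by lia.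
rewrite -[- qF ^+ h]mulN1r expfzMl.
(* Here d = 2e+1 and v = 2b+1, so v d = 2 (2be + b + e) + 1. *)
pose e := d./2%:Z; pose b := h%:Z - 1 - a%:Z.
have -> : (-1) ^ ((h.*2%:Z - 1 - 2 * a%:Z) * d) = -1 :> ratfun.
  rewrite -[RHS](exprz_sign_odd ratfun (2 * b * e + b + e)); congr (_ ^ _).
  have -> : d%:Z = 2 * e + 1 by rewrite /e; lia.
  by rewrite /b -muln2 PoszM; ring.
rewrite mulrCA; congr (_ * _).
rewrite /y -!exprM !exprnP exprz_exp -expfzDr ?qF_neq0 //; congr (_ ^ _).
have := bin2S_double a; have := bin2S_double (h.*2.-1 - a).
nia.
Qed.

(** * Specialization to s = m, by parity of n *)

Theorem theorem1p1 (n d : nat) (r : int) (f : nat -> {poly int}) (a : nat) :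
  (2 <= n)%N -> (1 <= d)%N -> coprime n d ->
  (a < n)%N -> (n%:Z %| a%:Z * d%:Z + r)%Z ->
  let S (g : nat -> ratfun) :=
    \sum_(0 <= k < n)
      qpoch (qF ^ r) (qF ^+ d) k * qpoch (qF ^ (d%:Z - r)) (qF ^+ d) k
        / (qpoch (qF ^+ d) (qF ^+ d) k) ^+ 2
        * qF ^+ (d * k) * g k in
  let E : int := (d * 'C(a.+1, 2))%:Z
                 + (((a%:Z * d%:Z + r) * (n%:Z - 1 - 2 * a%:Z)) %/ 2)%Z in
  let sgn : ratfun :=
    if odd n then (-1) ^+ a
    else (-1) ^ (a%:Z + ((a%:Z * d%:Z + r) %/ n%:Z)%Z) in
  congr_Phi2 n (qF ^ E * S (fun k => peval (f k) (qF ^+ d)))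
               (sgn * S (fun k => fhat f (qF ^+ d) k)).
Proof.
move=> n2 d1 nd ltan dvd_n S E sgn.
have n0 : (0 < n)%N by apply: ltnW.
pose m := ((a%:Z * d%:Z + r) %/ n%:Z)%Z.
have mE : a%:Z * d%:Z + r = m * n by rewrite divzK.
have rE : r = m * n - a%:Z * d%:Z by rewrite -mE; ring.
pose y := qF ^+ d; pose x := y ^- a * (qF ^+ n) ^ m.
have qX (z : int) (k : nat) : (qF ^+ k) ^ z = qF ^ (z * k).
  by rewrite exprnP exprz_exp mulrC.
have yVa : y ^- a = qF ^ (- (a%:Z * d%:Z)).
  by rewrite /y -exprM exprnP -invr_expz PoszM mulrC.
have xE : x = qF ^ r.
  by rewrite /x qX yVa -expfzDr ?qF_neq0 // rE addrC.
have yxE : y / x = qF ^ (d%:Z - r).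
  by rewrite xE /y exprnP invr_expz -expfzDr ?qF_neq0.
have SE g : S g = wsum n d g x.
  by apply: eq_bigr => k _; rewrite /pochq2 -/y yxE xE /y exprM.
(* [congr_Phi2] unfolds to membership of the difference in the second ideal. *)
rewrite !SE; change (idl 'Phi_n 2 (qF ^ E * wsum n d (fun k => peval (f k) y) x
  - sgn * wsum n d (fhat f y) x)).
have [on | en] := boolP (odd n).
  pose h := n./2; have nE : n = h.*2.+1 by rewrite -[LHS]odd_double_half on.
  have -> : qF ^ E = y ^+ 'C(a.+1, 2) * (qF ^+ n) ^ ((h%:Z - a%:Z) * m).
    rewrite qX /y -exprM exprnP -expfzDr ?qF_neq0 //; congr (_ ^ (_ + _)).
    rewrite mE [in LHS]nE.
    have -> : m * h.*2.+1 * (h.*2.+1%:Z - 1 - 2 * a%:Z) =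
              (m * h.*2.+1 * (h%:Z - a%:Z)) * 2.
      by rewrite -addn1 PoszD -muln2 PoszM; ring.
    by rewrite mulzK // nE; ring.
  have -> : sgn = (-1) ^+ a by rewrite /sgn on.
  apply: wsum_congr => //; first by rewrite expf_neq0 ?qF_neq0.
  - exact: idl_qFn_sub1.
  - by rewrite -exprVn; apply/idl0X/idl_qFV.
  - by rewrite [in n.-1]nE [in qF ^+ n]nE; apply: weight_odd; lia.
pose h := n./2; have nE : n = h.*2 by rewrite -[LHS]odd_double_half (negbTE en).
have h0 : (0 < h)%N by lia.
have od : odd d.
  apply: contraLR nd => ed; rewrite /coprime; apply/eqP => g1.
  have : (2 %| gcdn n d)%N by rewrite dvdn_gcd !dvdn2 en ed.
  by rewrite g1.
pose v := n%:Z - 1 - 2 * a%:Z.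
(* Since v is odd, passing from q^h to -q^h costs (-1)^m. This is the extra sign of the even case,
   and it factors out of both sides. *)
have signv : (-1) ^ (v * m) = (-1) ^ m :> ratfun.
  have -> : v * m = 2 * ((h%:Z - 1 - a%:Z) * m) + m.
    by rewrite /v nE -muln2 PoszM; ring.
  by rewrite expfzDr ?oppr_eq0 ?oner_eq0 // -exprz_exp -exprnP sqrrN expr1n exp1rz mul1r.
have signm : (-1) ^ m * (-1) ^ m = 1 :> ratfun.
  by rewrite -expfzMl mulrNN mulr1 exp1rz.
have -> : qF ^ E = (-1) ^ m * (y ^+ 'C(a.+1, 2) * (- qF ^+ h) ^ (v * m)).
  rewrite -[- qF ^+ h]mulN1r expfzMl signv [RHS]mulrCA [X in _ * X]mulrA signm mul1r.
  rewrite qX /y -exprM exprnP -expfzDr ?qF_neq0 //; congr (_ ^ (_ + _)).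
  rewrite mE -/v.
  have -> : m * n%:Z * v = (v * m * h) * 2 by rewrite [in LHS]nE -muln2 PoszM; ring.
  by rewrite mulzK.
have -> : sgn = (-1) ^ m * (-1) ^+ a.
  by rewrite /sgn (negbTE en) -/m expfzDr ?oppr_eq0 ?oner_eq0 // mulrC.
rewrite -!mulrA -mulrBr !mulrA.
apply: (@idlM _ 0 2).
  case: (intP m) => [|k|k]; first by rewrite expr0z; apply: idl0_1.
    exact: idl_sign.
  by rewrite -invr_expz -exprnP invr_sign; apply: idl_sign.
have Q1 : idl 'Phi_n 1 (- qF ^+ h - 1).
  rewrite -polyFX -opprD -polyF1 -polyFD; apply: idlN; apply: idl_dvd.
  by rewrite nE -mul2n; apply: Cyclotomic_dvd_Xn_add1.
apply: wsum_congr => //; first by rewrite oppr_eq0 expf_neq0 ?qF_neq0.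
- by rewrite invrN -exprVn; apply/idlN/idl0X/idl_qFV.
- by rewrite /v nE; apply: weight_even => //; rewrite -nE.
Qed.
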